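(* Let $r$ be a positive integer and $0 \le a \le 1$. Define $h : \binom{[3]}{2} \to [0,1]$ by $h(12) = h(13) = a$ and $h(23) = 0$, and let $\mathcal{F} = \{(3,h), K_{r+1}^0\}$. Then $$d(\mathcal{F}) = \begin{cases} \frac12, & \text{if } a \le \frac12,\\ a + \frac{1-2a}{r}, & \text{if } a > \frac12 \text{ and } r \text{ is even},\\ \frac{a^2(r-1)}{a(r+1)-1}, & \text{if } a > \frac12 \text{ and } r \text{ is odd}.\end{cases}$$
   Context: An edge weighting of a graph $G$ is a map $w : E(G) \to [0,1]$; for an $n$-vertex graph, $w(G) := \frac{2}{n^2}\sum_{e\in E(G)} w(e)$. A weighted clique is a pair $(r,f)$ with $f : \binom{[r]}{2} \to [0,1]$; $(G,w)$ contains $(r,f)$ if there is an injective $\phi:[r]\to V(G)$ with $\phi(i)\phi(j) \in E(G)$ and $w(\phi(i)\phi(j)) > f(ij)$ for all $i<j$. For $a \in [0,1]$, $K_r^a$ is the weighted clique $(r,f)$ with $f \equiv a$. For a set $\mathcal{F}$ of weighted cliques, $(G,w)$ is $\mathcal{F}$-free if it contains none of them; $\beta_n(\mathcal{F})$ is the maximum of $w(G)$ over $\mathcal{F}$-free weighted graphs on $n$ vertices, and $d(\mathcal{F}) := \lim_{n\to\infty}\beta_n(\mathcal{F})$.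
   Formalization: The case r = 1 with a ≤ 1/2 is excluded: there K_2^0 is forbidden, so all edges have weight 0 and d(F) = 0, not 1/2 as printed; all other cases are as stated. *)

(* Defs.v *)
From HB Require Import structures.
From mathcomp Require Import all_boot all_order all_algebra.
From mathcomp Require Import boolp classical_sets reals topology normedtype.
From mathcomp Require Import sequences.

Set Implicit Arguments.
Unset Strict Implicit.
Unset Printing Implicit Defensive.

Import Order.TTheory GRing.Theory Num.Theory.
Import numFieldNormedType.Exports.

Local Open Scope ring_scope.

Record sgraph (V : finType) := SGraph {
  edges : {set {set V}};
  edges_card2 : forall e, e \in edges -> #|e| = 2%N }.

(* Only the values of [w] on [edges G] are meaningful. *)
Definition edge_weighting (R : realType) (V : finType) (G : sgraph V)
    (w : {set V} -> R) : Prop :=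
  forall e, e \in edges G -> 0 <= w e <= 1.

Definition total_weight (R : realType) (V : finType) (G : sgraph V)
    (w : {set V} -> R) : R :=
  2 / #|V|%:R ^+ 2 * \sum_(e in edges G) w e.

(* The vertex set {1, .., r} is 'I_r, shifted by one; [wc_fun] only matters on 2-sets. *)
Record wclique (R : realType) := WClique {
  wc_size : nat;
  wc_fun : {set 'I_wc_size} -> R;
  wc_fun01 : forall e : {set 'I_wc_size}, #|e| = 2%N -> 0 <= wc_fun e <= 1 }.

Definition wcontains (R : realType) (V : finType) (G : sgraph V)
    (w : {set V} -> R) (C : wclique R) : Prop :=
  exists phi : 'I_(wc_size C) -> V,
    injective phi /\
    forall i j : 'I_(wc_size C), (i < j)%N ->
      [set phi i; phi j]%SET \in edges G /\
      wc_fun [set i; j]%SET < w [set phi i; phi j]%SET.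

Definition wfree (R : realType) (V : finType) (F : set (wclique R))
    (G : sgraph V) (w : {set V} -> R) : Prop :=
  forall C, F C -> ~ wcontains G w C.

Definition free_weights (R : realType) (F : set (wclique R)) (n : nat) : set R :=
  [set x | exists (G : sgraph 'I_n) (w : {set 'I_n} -> R),
     [/\ edge_weighting G w, wfree F G w & x = total_weight G w]]%classic.

(* "beta_n(F) = b": the maximum is required to be attained. *)
Definition is_beta (R : realType) (F : set (wclique R)) (n : nat) (b : R) : Prop :=
  free_weights F n b /\ ubound (free_weights F n) b.

(* "d(F) = l": every beta_n(F) exists and the limit exists and equals l. *)
Definition is_density (R : realType) (F : set (wclique R)) (l : R) : Prop :=
  exists beta : nat -> R,
    (forall n, is_beta F n (beta n)) /\ (beta n @[n --> \oo] --> l)%classic.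

Definition Kclique (R : realType) (r : nat) (a : R) (ha : 0 <= a <= 1) :
    wclique R :=
  @WClique R r (fun=> a) (fun _ _ => ha).

Lemma zero01 (R : realType) : 0 <= (0 : R) <= 1.
Proof. by rewrite lexx ler01. Qed.

(* 'I_3 = {0, 1, 2} stands for {1, 2, 3}, so {1, 2} is the pair 23. *)
Definition h_fun (R : realType) (a : R) (e : {set 'I_3}) : R :=
  if e == [set inord 1; inord 2]%SET then 0 else a.

Lemma h_fun01 (R : realType) (a : R) (ha : 0 <= a <= 1) (e : {set 'I_3}) :
  #|e| = 2%N -> 0 <= h_fun a e <= 1.
Proof. by move=> _; rewrite /h_fun; case: ifP => // _; apply: zero01. Qed.

Definition h_clique (R : realType) (a : R) (ha : 0 <= a <= 1) : wclique R :=
  @WClique R 3 (h_fun a) (h_fun01 ha).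

Definition forbidden (R : realType) (r : nat) (a : R) (ha : 0 <= a <= 1) :
    set (wclique R) :=
  [set h_clique ha; Kclique r.+1 (zero01 R)]%classic.

(* Main.v *)
Require Import Defs.
From HB Require Import structures.
From mathcomp Require Import all_boot all_order all_algebra.
From mathcomp Require Import boolp classical_sets reals topology normedtype.
From mathcomp Require Import sequences.
From mathcomp Require Import ring lra zify.

Set Implicit Arguments.
Unset Strict Implicit.
Unset Printing Implicit Defensive.

Import Order.TTheory GRing.Theory Num.Theory.
Import numFieldNormedType.Exports.

Local Open Scope ring_scope.

(** Upper bound: the weight of a graph is the value at the uniform distribution
    of a quadratic form on the simplex of vertex distributions.  Zykov
    symmetrization moves all mass onto a clique, of size at most [r], whose edges
    heavier than [a] form a matching.  There the form is at most
    [a - \sum_u d_u x_u^2] with [d_u = 2a - 1] on matched vertices and [d_u = a]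
    on the others, and Cauchy-Schwarz gives [a - 1 / \sum_u d_u^-1]; the sum is
    largest when as many of the [r] vertices as parity allows are matched.  If
    [a <= 1/2], the same argument with [a] replaced by [1/2] gives [1/2].

    Lower bound: blow up the extremal clique, adding vertices one at a time to a
    class of largest current weight.  At the optimal distribution every class
    sees the same weight [d], so [n] vertices carry at least [d (1 - 1/n)]. *)

(** * Quadratic forms and Zykov symmetrization *)

Lemma sum_pairs (M : nmodType) (V : finType) (F : {set V} -> M) :
  \sum_u \sum_v (if u != v then F [set u; v]%SET else 0) =
  (\sum_(e : {set V} | #|e| == 2%N) F e) *+ 2.
Proof.
rewrite pair_big /= -big_mkcond /=.
rewrite (partition_big (fun p : V * V => [set p.1; p.2]%SET)
  (fun e : {set V} => #|e| == 2%N)) /=; last by move=> p; rewrite cards2 => ->.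
rewrite -sumrMnl; apply: eq_bigr => e /cards2P [p [q [pq ->]]].
rewrite (bigD1 (p, q)) /= ?pq ?eqxx // (bigD1 (q, p)) /=; last first.
  by rewrite eq_sym pq finset.setUC eqxx /= xpair_eqE eq_sym (negbTE pq).
rewrite big1 ?addr0 => [|[u v] /=]; first by rewrite finset.setUC mulr2n.
case/andP => /andP [/andP [uv /eqP E] n1] n2.
have up : u \in [set p; q]%SET by rewrite -E !inE eqxx.
have vp : v \in [set p; q]%SET by rewrite -E !inE eqxx orbT.
move: up vp n1 n2 uv; rewrite !inE !xpair_eqE.
by case/orP => /eqP -> /orP [] /eqP ->; rewrite !eqxx ?andbF.
Qed.

Section QuadraticForm.
Context {R : realType} {V : finType}.
Implicit Types (W : V -> V -> R) (x : V -> R).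

Definition qform W x : R := \sum_u x u * \sum_v x v * W u v.

Lemma sum_shift x (F : V -> R) (c : R) (u v : V) :
  \sum_t (x t + c * ((t == u)%:R - (t == v)%:R)) * F t =
  \sum_t x t * F t + c * (F u - F v).
Proof.
have D (p : V) : \sum_t (t == p)%:R * F t = F p.
  by rewrite (bigD1 p) //= eqxx mul1r big1 ?addr0 // => t /negbTE ->; rewrite mul0r.
rewrite -(D u) -(D v) -sumrB mulr_sumr -big_split /=.
by apply: eq_bigr => t _; ring.
Qed.

(** The coefficient of [c ^+ 2] is [W u u - 2 * W u v + W v v], which vanishes here, so the change
    is linear in the transferred mass [c]. *)
Lemma qform_shift W x (c : R) (u v : V) :
  (forall s t, W s t = W t s) -> (forall s, W s s = 0) -> W u v = 0 ->
  qform W (fun t => x t + c * ((t == u)%:R - (t == v)%:R)) =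
  qform W x + 2 * c * (\sum_t x t * W u t - \sum_t x t * W v t).
Proof.
move=> Ws W0 uv; rewrite /qform.
under eq_bigr => s _ do rewrite sum_shift.
rewrite sum_shift !W0 (Ws v u) uv.
under [X in X + _]eq_bigr => s _ do rewrite mulrDr mulrCA mulrBr (Ws s u) (Ws s v).
by rewrite big_split /= -mulr_sumr sumrB; ring.
Qed.

(* Zykov symmetrization: between two non-adjacent vertices the form is affine
   along mass transfer, so one of the two can be emptied. *)
Lemma qform_le_cliques W (l : R) :
  (forall s t, W s t = W t s) -> (forall s, W s s = 0) ->
  (forall x, (forall u, 0 <= x u) ->
    (forall u v, x u != 0 -> x v != 0 -> u != v -> W u v != 0) ->
    qform W x <= l * (\sum_u x u) ^+ 2) ->
  forall x, (forall u, 0 <= x u) -> qform W x <= l * (\sum_u x u) ^+ 2.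
Proof.
move=> Ws W0 clique x.
have [k] := ubnP #|[pred u | x u != 0]|; elim: k x => // k IH x ltk x0.
have [/existsP [u /existsP [v /and4P [xu xv uv /eqP Wuv]]]|none] :=
  boolP [exists u, exists v, [&& x u != 0, x v != 0, u != v & W u v == 0]]; last first.
  apply: clique => // u v xu xv uv; apply: contra none => Wuv.
  by apply/existsP; exists u; apply/existsP; exists v; rewrite xu xv uv.
wlog gle : u v xu xv uv Wuv / \sum_t x t * W v t <= \sum_t x t * W u t => [H|].
  case: (leP (\sum_t x t * W v t) (\sum_t x t * W u t)) => [|/ltW] gle.
    exact: (H u v).
  by apply: (H v u) => //; rewrite 1?eq_sym // Ws.
(* All the mass of [v] goes to [u]. As [u] already carries mass, the support loses [v] and gains
   nothing, which drives the induction on its size. *)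
pose y t := x t + x v * ((t == u)%:R - (t == v)%:R).
have yv : y v = 0 by rewrite /y eqxx eq_sym (negbTE uv) /=; ring.
have sy : \sum_t y t = \sum_t x t.
  have := sum_shift x (fun=> 1) (x v) u v; rewrite subrr mulr0 addr0.
  by under eq_bigr do rewrite mulr1; under [in RHS]eq_bigr do rewrite mulr1.
have y0 t : 0 <= y t.
  have [->|tv] := eqVneq t v; first by rewrite yv.
  by rewrite /y (negbTE tv) subr0 addr_ge0 // mulr_ge0.
have ltky : (#|[pred t | y t != 0%R]| < k)%N.
  rewrite -ltnS; apply: leq_trans ltk; rewrite ltnS; apply: proper_card.
  apply/properP; split; last by exists v; rewrite !inE // yv eqxx.
  apply/fintype.subsetP => t; rewrite !inE; apply: contraNN => /eqP xt.
  have [->|tv] := eqVneq t v; first by rewrite yv.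
  have tu : t != u by apply: contraNneq xu => <-; rewrite xt.
  by rewrite /y xt (negbTE tu) (negbTE tv) subrr mulr0 addr0.
rewrite -sy; apply: le_trans (IH y ltky y0).
rewrite qform_shift // lerDl !mulr_ge0 ?subr_ge0 //.
Qed.

End QuadraticForm.

(* The reciprocal of the defect [a - d(F)] when [1/2 < a]. *)
Definition inv_defect {R : realType} (r : nat) (a : R) : R :=
  r%:R / a + (r - odd r)%:R * ((2 * a - 1)^-1 - a^-1).

(** * The form on a clique whose heavy edges form a matching *)

Section CliqueBound.
Context {R : realType} {V : finType}.
Variables (a : R) (heavy : {set V} -> bool) (S : {set V}) (x : V -> R).

Definition hdeg (u : V) : nat := \sum_(v in S) ((u != v) && heavy [set u; v]%SET).

(** Handshake argument: every heavy pair inside [S] is counted from both ends. This is where the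
    parity of [r] enters. *)
Lemma sum_hdeg_even : ~~ odd (\sum_(u in S) hdeg u).
Proof.
have -> : (\sum_(u in S) hdeg u =
    \sum_u \sum_v if u != v then
      ((fun e : {set V} => (e \subset S) && heavy e) [set u; v]%SET : nat) else 0)%N.
  rewrite big_mkcond; apply: eq_bigr => u _.
  case: ifP => uS.
    rewrite /hdeg big_mkcond; apply: eq_bigr => v _.
    by rewrite finset.subUset !finset.sub1set uS /=; case: (v \in S); case: (u != v).
  by rewrite big1 // => v _; rewrite finset.subUset !finset.sub1set uS /=; case: (u != v).
by have := sum_pairs (fun e : {set V} => ((e \subset S) && heavy e : nat));
  rewrite /= => ->; rewrite mulr2n oddD addbb.
Qed.

Hypothesis a1 : a <= 1.
Hypothesis x0 : forall u, 0 <= x u.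
Hypothesis xS : forall u, u \notin S -> x u = 0.
Hypothesis matching : forall u, u \in S -> (hdeg u <= 1)%N.
Variable W : V -> V -> R.
Hypothesis Wdiag : forall u, W u u = 0.
Hypothesis Wle : forall u v, u != v ->
  W u v <= a + (1 - a) * (heavy [set u; v]%SET)%:R.

(** The missing diagonal costs [a * x u ^+ 2] at each [u]. On a heavy pair,
    [x u * x v <= (x u ^+ 2 + x v ^+ 2) / 2] splits the excess [1 - a] evenly between the two
    ends. *)
Lemma qform_le_hdeg : qform W x <=
  a * (\sum_u x u) ^+ 2 - \sum_(u in S) (a - (1 - a) * (hdeg u)%:R) * x u ^+ 2.
Proof.
have -> : \sum_u x u = \sum_(u in S) x u.
  by rewrite [RHS]big_mkcond; apply: eq_bigr => u _; case: ifPn => // /xS.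
have -> : qform W x = \sum_(u in S) \sum_(v in S) x u * x v * W u v.
  rewrite /qform [RHS]big_mkcond; apply: eq_bigr => u _.
  case: ifPn => [_|/xS ->]; last by rewrite mul0r.
  rewrite mulr_sumr [RHS]big_mkcond; apply: eq_bigr => v _.
  by case: ifPn => [_|/xS ->]; rewrite ?mul0r ?mulr0 ?mulrA.
pose h u v : R := ((u != v) && heavy [set u; v]%SET)%:R.
have hs u v : h u v = h v u by rewrite /h eq_sym finset.setUC.
have hd u : (hdeg u)%:R = \sum_(v in S) h u v by rewrite /hdeg natr_sum.
have step : \sum_(u in S) \sum_(v in S) x u * x v * W u v <=
  \sum_(u in S) \sum_(v in S) (a * (x u * x v) - a * (x u * x v * (u == v)%:R)
     + (1 - a) / 2 * (x u ^+ 2 * h u v) + (1 - a) / 2 * (x v ^+ 2 * h v u)).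
  apply: ler_sum => u _; apply: ler_sum => v _.
  rewrite (hs v u) /h; have [->|uv] := eqVneq u v; first by rewrite Wdiag /=; lra.
  apply: le_trans (ler_wpM2l (mulr_ge0 (x0 u) (x0 v)) (Wle uv)) _.
  case: (heavy _) => /=; last by lra.
  have: 0 <= (1 - a) / 2 * (x u - x v) ^+ 2.
    by rewrite mulr_ge0 ?sqr_ge0 //; move: a1; lra.
  by rewrite !mulr1 mulr0; lra.
apply: (le_trans step); rewrite le_eqVlt; apply/orP; left; apply/eqP.
have E1 : \sum_(u in S) \sum_(v in S) x u ^+ 2 * h u v =
    \sum_(u in S) x u ^+ 2 * (hdeg u)%:R.
  by apply: eq_bigr => u _; rewrite hd mulr_sumr.
have E2 : \sum_(u in S) \sum_(v in S) x v ^+ 2 * h v u =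
    \sum_(u in S) x u ^+ 2 * (hdeg u)%:R.
  by rewrite exchange_big.
have E3 : \sum_(u in S) \sum_(v in S) x u * x v * (u == v)%:R =
    \sum_(u in S) x u ^+ 2.
  apply: eq_bigr => u uS; rewrite (bigD1 u) //= eqxx mulr1 big1 ?addr0 ?expr2 //.
  by move=> v /andP [_ /negbTE vu]; rewrite eq_sym vu mulr0.
have E4 : \sum_(u in S) \sum_(v in S) x u * x v = (\sum_(u in S) x u) ^+ 2.
  by rewrite expr2 mulr_suml; apply: eq_bigr => u _; rewrite mulr_sumr.
transitivity (a * (\sum_(u in S) x u) ^+ 2 - a * (\sum_(u in S) x u ^+ 2)
  + (1 - a) / 2 * (\sum_(u in S) x u ^+ 2 * (hdeg u)%:R)
  + (1 - a) / 2 * (\sum_(u in S) x u ^+ 2 * (hdeg u)%:R)).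
  rewrite -{1}E1 -E2 -E3 -E4 !mulr_sumr -sumrB -!big_split /=; apply: eq_bigr => u _.
  by rewrite !mulr_sumr -sumrB -!big_split.
rewrite [X in _ = _ - X](_ : _ = a * \sum_(u in S) x u ^+ 2 -
  (1 - a) * \sum_(u in S) x u ^+ 2 * (hdeg u)%:R); last first.
  by rewrite !mulr_sumr -sumrB; apply: eq_bigr => u _; ring.
by field.
Qed.

Lemma qform_clique_half : a = 1 / 2 -> qform W x <= 1 / 2 * (\sum_u x u) ^+ 2.
Proof.
move=> ah; apply: (le_trans qform_le_hdeg); rewrite ah gerBl; apply: sumr_ge0 => u uS.
apply: mulr_ge0 (sqr_ge0 _).
by have := matching uS; case: (hdeg u) => [|[|]] // _; lra.
Qed.

Lemma qform_clique (r : nat) : 1 / 2 < a -> (0 < r)%N -> (#|S| <= r)%N ->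
  qform W x <= (a - (inv_defect r a)^-1) * (\sum_u x u) ^+ 2.
Proof.
move=> a2' r0 Sr; apply: (le_trans qform_le_hdeg).
have ap : 0 < a by lra.
have bp : 0 < 2 * a - 1 by lra.
(* Gain in the reciprocal of the coefficient when a vertex becomes matched. *)
pose del := (2 * a - 1)^-1 - a^-1.
have del0 : 0 <= del by rewrite subr_ge0 lef_pV2 ?posrE //; move: a1; lra.
set T := inv_defect r a.
have Tp : 0 < T.
  by rewrite ltr_wpDr ?mulr_ge0 ?ler0n // divr_gt0 ?ltr0n.
set s := \sum_u x u.
have sS : s = \sum_(u in S) x u.
  by rewrite [RHS]big_mkcond; apply: eq_bigr => u _; case: ifPn => // /xS.
(* Tangent-line form of Cauchy-Schwarz:
   [- d x^2 <= lam^2 / d - 2 lam x] with [lam = s / T]. *)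
have tangent (d y lam : R) : 0 < d -> - (d * y ^+ 2) <= lam ^+ 2 * d^-1 - 2 * lam * y.
  move=> dp; rewrite -subr_ge0.
  have -> : lam ^+ 2 / d - 2 * lam * y - - (d * y ^+ 2) = (d * y - lam) ^+ 2 / d.
    by field; rewrite gt_eqF.
  by rewrite divr_ge0 ?sqr_ge0 // ltW.
(* The degree sum is even and at most [#|S|], so an odd [r] loses one. *)
have M_le : (\sum_(u in S) hdeg u <= r - odd r)%N.
  have: (\sum_(u in S) hdeg u <= r)%N.
    apply: leq_trans Sr; rewrite -sum1_card; exact: leq_sum.
  have := sum_hdeg_even; move: (\sum_(u in S) _)%N => M; lia.
(* The right-hand side equals [- s ^+ 2 / T]. *)
have bound : - (\sum_(u in S) (a - (1 - a) * (hdeg u)%:R) * x u ^+ 2) <=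
   (s / T) ^+ 2 * T - 2 * (s / T) * s.
  apply: (@le_trans _ _ (\sum_(u in S) ((s / T) ^+ 2 * (a^-1 + del * (hdeg u)%:R)
     - 2 * (s / T) * x u))).
    rewrite -sumrN; apply: ler_sum => u uS.
    apply: (le_trans (tangent _ (x u) (s / T) _)).
      by have := matching uS; case: (hdeg u) => [|[|]] // _; lra.
    suff -> : (a - (1 - a) * (hdeg u)%:R)^-1 = a^-1 + del * (hdeg u)%:R by [].
    have := matching uS; case: (hdeg u) => [|[|]] // _;
      rewrite ?(mulr0, mulr1, subr0, addr0) //.
    by rewrite /del [RHS]addrC subrK; congr (_^-1); lra.
  rewrite sumrB -!mulr_sumr -sS lerD2r; apply: ler_wpM2l; first exact: sqr_ge0.
  rewrite big_split /= -mulr_sumr sumr_const -natr_sum /T /inv_defect -/del.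
  rewrite -[a^-1 *+ _]mulr_natl lerD //.
    by rewrite ler_pM2r ?invr_gt0 // ler_nat.
  by rewrite mulrC ler_wpM2r // ler_nat.
apply: le_trans (lerD (lexx _) bound) _.
rewrite le_eqVlt; apply/orP; left; apply/eqP; field; rewrite gt_eqF //.
Qed.

End CliqueBound.

(** * From free weighted graphs to the form: the upper bound *)

Section AdjacencyMatrix.
Context {R : realType} {V : finType}.
Variables (G : sgraph V) (w : {set V} -> R).

(** Edges of weight 0 are merged with non-edges; this is harmless because containment asks for
    weights strictly above values in [0,1]. *)
Definition adj (u v : V) : R :=
  if [set u; v]%SET \in edges G then w [set u; v]%SET else 0.

Lemma adjC u v : adj u v = adj v u.
Proof. by rewrite /adj finset.setUC. Qed.

Lemma edge_neq u v : [set u; v]%SET \in edges G -> u != v.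
Proof.
by move=> /edges_card2; rewrite cards2; case: (u != v).
Qed.

Lemma adj_diag u : adj u u = 0.
Proof. by rewrite /adj; case: ifP => // /edge_neq; rewrite eqxx. Qed.

Lemma adj_gt u v c : 0 <= c -> c < adj u v ->
  [set u; v]%SET \in edges G /\ c < w [set u; v]%SET.
Proof. by rewrite /adj; case: ifP => // _ c0 /(le_lt_trans c0); rewrite ltxx. Qed.

Lemma total_weight_qform :
  total_weight G w = qform adj (fun=> 1) / #|V|%:R ^+ 2.
Proof.
rewrite /total_weight /qform [RHS]mulrC -mulrA mulrCA; congr (_ * _).
under [RHS]eq_bigr do rewrite mul1r.
under [RHS]eq_bigr do under eq_bigr do rewrite mul1r.
transitivity ((\sum_(e : {set V} | #|e| == 2%N)
    if e \in edges G then w e else 0) *+ 2).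
  rewrite mulr_natl -big_mkcondr /=; congr (_ *+ 2); apply: eq_bigl => e.
  by apply/idP/andP => [eG|[]//]; rewrite (edges_card2 eG).
rewrite -sum_pairs; apply: eq_bigr => u _; apply: eq_bigr => v _.
by have [->|] := eqVneq u v; rewrite ?adj_diag.
Qed.

Lemma h_fun_le (a : R) e : 0 <= a -> h_fun a e <= a.
Proof. by rewrite /h_fun; case: ifP. Qed.

Lemma wcontains_h (a : R) (ha : 0 <= a <= 1) u v t : v != t ->
  a < adj u v -> a < adj u t -> 0 < adj v t -> wcontains G w (h_clique ha).
Proof.
have a0 : 0 <= a by case/andP: ha.
move=> vt /(adj_gt a0) [uvG uvw] /(adj_gt a0) [utG utw] /(adj_gt (lexx 0)) [vtG vtw].
(* [u] is the vertex lying on both pairs of value [a]; [v] and [t] form the pair of value 0. *)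
exists (tnth [tuple u; v; t]); split.
  apply/tuple_uniqP; rewrite /= !inE negb_or vt (edge_neq uvG) (edge_neq utG) //.
move=> i j ij; rewrite /= !(tnth_nth u) /=.
case: i j ij => [[|[|[|i]]] Hi] [[|[|[|j]]] Hj] //= _.
- by split => //; apply: le_lt_trans uvw; exact: h_fun_le.
- by split => //; apply: le_lt_trans utw; exact: h_fun_le.
split => //; rewrite /h_fun; case: eqP => // -[].
by congr ([set _; _]%SET); apply/val_inj; rewrite /= inordK.
Qed.

Lemma wcontains_K (r : nat) (S : {set V}) : (r < #|S|)%N ->
  {in S &, forall u v, u != v -> 0 < adj u v} ->
  wcontains G w (Kclique r.+1 (zero01 R)).
Proof.
move=> rS clique.
have inj : injective (fun i : 'I_r.+1 => enum_val (widen_ord rS i)).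
  by move=> i j /enum_val_inj /(congr1 val) /= ij; apply/val_inj.
exists (fun i : 'I_r.+1 => enum_val (widen_ord rS i)); split => // i j ij.
apply: adj_gt (lexx 0) _; apply: clique; rewrite ?enum_valP //.
by rewrite (inj_eq inj) neq_ltn ij.
Qed.

End AdjacencyMatrix.

Definition density_value {R : realType} (r : nat) (a : R) : R :=
  if a <= 1 / 2 then 1 / 2 else a - (inv_defect r a)^-1.

Lemma total_weight_le {R : realType} (V : finType) (G : sgraph V) w (r : nat)
    (a : R) (ha : 0 <= a <= 1) : (0 < r)%N -> (0 < #|V|)%N ->
  edge_weighting G w -> wfree (forbidden r ha) G w ->
  total_weight G w <= density_value r a.
Proof.
move=> r0 V0 w01 free; have /andP [a0 a1] := ha.
have V0' : 0 < #|V|%:R :> R by rewrite ltr0n.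
rewrite total_weight_qform ler_pdivrMr ?exprn_gt0 //.
have -> : #|V|%:R = \sum_(u : V) 1 :> R by rewrite sumr_const cardT -cardE.
apply: qform_le_cliques; [exact: adjC|exact: adj_diag| |by move=> u; exact: ler01].
move=> x x0 clique.
pose S := [set u | x u != 0]%SET.
have adj_ge0 u v : 0 <= adj G w u v.
  by rewrite /adj; case: ifP => // /w01 /andP [].
have adjS : {in S &, forall u v, u != v -> 0 < adj G w u v}.
  by move=> u v; rewrite !inE => xu xv uv; rewrite lt_def adj_ge0 clique.
have xS u : u \notin S -> x u = 0 by rewrite inE negbK => /eqP.
pose heavy (e : {set V}) := (e \in edges G) && (a < w e).
have heavyE u v : heavy [set u; v]%SET = (a < adj G w u v).
  rewrite /heavy; apply/andP/idP => [[eG]|/(adj_gt a0) //].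
  by rewrite /adj eG.
(* Two heavy neighbours of [u] in the support are joined by positive weight, so they would complete
   a copy of [h_clique]. *)
have matching u : u \in S -> (hdeg heavy S u <= 1)%N.
  move=> uS; rewrite /hdeg -big_mkcondr sum1_card /=.
  apply/card_le1_eqP => v t.
  rewrite !unfold_in /= => /andP [vS /andP [uv hv]] /andP [tS /andP [ut ht]].
  apply/eqP; rewrite eq_sym; apply/negPn/negP => vt.
  apply: (free (h_clique ha)); first by left.
  by apply: (wcontains_h (u := u) ha vt); [rewrite -heavyE|rewrite -heavyE|exact: adjS].
have Sr : (#|S| <= r)%N.
  rewrite leqNgt; apply/negP => rS.
  by apply: (free (Kclique r.+1 (zero01 R))); [right|apply: wcontains_K adjS].
(* Used with [b = 1 / 2] when [a <= 1 / 2] and with [b = a] otherwise; [heavy] keeps the threshold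
   [a] in both cases. *)
have adj_le (b : R) u v : a <= b -> b <= 1 -> u != v ->
    adj G w u v <= b + (1 - b) * (heavy [set u; v]%SET)%:R.
  move=> ab b1 uv; rewrite heavyE.
  case: ltP => [_|/le_trans/(_ ab)]; last by rewrite mulr0 addr0.
  rewrite mulr1 addrC subrK /adj; case: ifP => [/w01 /andP [] //|_]; exact: ler01.
rewrite /density_value; case: ifPn => [ah|]; last rewrite -ltNge => ah.
  apply: (qform_clique_half (a := 1 / 2) (heavy := heavy) (S := S)) => //;
    [lra|exact: adj_diag|move=> u v; apply: adj_le; lra].
apply: (qform_clique (heavy := heavy) (S := S)) => //;
  [exact: adj_diag|move=> u v; exact: adj_le].
Qed.

(** * Blow-ups of the extremal clique: the lower bound *)

(* Each new index is chosen to maximize its weight to the earlier ones; the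
   maximum is at least the [x]-average. *)
Lemma greedy_sequence {R : realType} (I : finType) (i0 : I) (A : I -> I -> R)
    (x : I -> R) (l : R) :
  (forall i j, A i j = A j i) -> (forall i, A i i = 0) ->
  (forall i, 0 <= x i) -> \sum_i x i = 1 ->
  (forall j, l <= \sum_i x i * A i j) ->
  forall n, exists s : n.-tuple I,
    l * (n%:R * (n%:R - 1)) <= \sum_(i <- s) \sum_(j <- s) A i j.
Proof.
move=> As A0 x0 x1 xA; elim=> [|n [s IH]].
  by exists [tuple]; rewrite big_nil mul0r mulr0.
pose f i := \sum_(j <- s) A i j.
have [i _ imax] := @arg_maxP _ R I i0 predT f isT.
exists [tuple of i :: s]; rewrite /= big_cons big_cons A0 add0r.
under [X in _ <= _ + X]eq_bigr => j _ do rewrite big_cons (As j i).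
rewrite big_split /=.
(* Prepending [i] adds [2 * f i] to the double sum, while the target grows by [2 * l * n]. *)
suff fi : l * n%:R <= f i by rewrite -natr1; move: IH fi; rewrite /f; lra.
have -> : f i = \sum_j x j * f i by rewrite -mulr_suml x1 mul1r.
apply: (@le_trans _ _ (\sum_j x j * f j)); last first.
  by apply: ler_sum => j _; apply: ler_wpM2l => //; exact: imax.
rewrite /f; under eq_bigr do rewrite mulr_sumr.
rewrite exchange_big /=.
have -> : l * n%:R = \sum_(j <- s) l.
  by rewrite big_const_seq count_predT size_tuple iter_addr_0 mulr_natr.
by apply: ler_sum => j _; exact: xA.
Qed.

Lemma complete_edges_card2 (V : finType) (e : {set V}) :
  e \in [set e : {set V} | #|e| == 2%N]%SET -> #|e| = 2%N.
Proof. by rewrite inE => /eqP. Qed.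

Definition complete_sgraph (V : finType) : sgraph V :=
  SGraph (@complete_edges_card2 V).

Lemma in_complete (V : finType) (u v : V) :
  ([set u; v]%SET \in edges (complete_sgraph V)) = (u != v).
Proof. by rewrite inE cards2; case: (u != v). Qed.

(* The extremal pattern: classes [2i] and [2i+1] are joined by weight 1, all other
   pairs of classes by weight [a]. *)
Definition pair_weight {R : realType} (a : R) (i j : nat) : R :=
  if i == j then 0 else if i./2 == j./2 then 1 else a.

Section PairWeight.
Context {R : realType} (a : R).
Local Notation A := (pair_weight a).

Lemma pair_weightC i j : A i j = A j i.
Proof. by rewrite /pair_weight eq_sym (eq_sym i./2). Qed.

Lemma pair_weightxx i : A i i = 0.
Proof. by rewrite /pair_weight eqxx. Qed.

Lemma pair_weight01 i j : 0 <= a <= 1 -> 0 <= A i j <= 1.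
Proof.
by rewrite /pair_weight => ha; case: ifP => _; [|case: ifP => _ //];
  rewrite ?lexx ?ler01.
Qed.

Lemma pair_weight_gt0 i j : 0 < A i j -> i != j.
Proof. by rewrite /pair_weight; case: (i == j); rewrite ?ltxx. Qed.

Lemma pair_weight_gt i j : 0 <= a -> a < A i j -> i != j /\ i./2 = j./2.
Proof.
rewrite /pair_weight => a0; case: eqP => [_ /(le_lt_trans a0)|_]; first by rewrite ltxx.
by case: eqP => //; rewrite ltxx.
Qed.

Variables (V : finType) (col : V -> nat).

(** Summing over ordered pairs and halving avoids choosing an order on the two ends of [e]. *)
Definition blowup_weight (e : {set V}) : R :=
  (\sum_(u in e) \sum_(v in e) A (col u) (col v)) / 2.

Lemma blowup_weightE u v : u != v -> blowup_weight [set u; v]%SET = A (col u) (col v).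
Proof.
move=> uv; have uv' : u \notin [set v]%SET by rewrite inE.
rewrite /blowup_weight big_setU1 //= !big_set1 !big_setU1 //= !big_set1.
by rewrite !pair_weightxx (pair_weightC (col v)); field.
Qed.

Lemma adj_blowup u v :
  adj (complete_sgraph V) blowup_weight u v = A (col u) (col v).
Proof.
rewrite /adj in_complete; have [->|uv] := eqVneq u v; first by rewrite pair_weightxx.
by rewrite blowup_weightE.
Qed.

Lemma blowup_weighting : 0 <= a <= 1 ->
  edge_weighting (complete_sgraph V) blowup_weight.
Proof.
move=> ha e; rewrite inE => /cards2P [u [v [uv ->]]].
by rewrite blowup_weightE // pair_weight01.
Qed.

(** A weight above [a] forces distinct colours with equal halves, and only two colours share a half,
    so no vertex has heavy edges to two colours. A positive weight forces distinct colours, and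
    there are at most [r] of them. *)
Lemma blowup_free (r : nat) (ha : 0 <= a <= 1) : (forall v, col v < r)%N ->
  wfree (forbidden r ha) (complete_sgraph V) blowup_weight.
Proof.
move=> colr C [] -> [phi [inj H]]; have /andP [a0 _] := ha.
  have wE (i j : 'I_3) : (i < j)%N ->
      blowup_weight [set phi i; phi j]%SET = A (col (phi i)) (col (phi j)).
    by move=> ij; rewrite blowup_weightE // (inj_eq inj) neq_ltn ij.
  have ha0 (j : 'I_3) : h_fun a [set ord0; j]%SET = a.
    rewrite /h_fun; case: eqP => // /setP /(_ ord0).
    by rewrite !inE -!val_eqE /= !inordK.
  have /(_ isT) [_ /=] := H ord0 (Ordinal (isT : 1 < 3)%N).
  rewrite wE // ha0 => /(pair_weight_gt a0) [n01 e01].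
  have /(_ isT) [_ /=] := H ord0 (Ordinal (isT : 2 < 3)%N).
  rewrite wE // ha0 => /(pair_weight_gt a0) [n02 e02].
  have /(_ isT) [_ /=] := H (Ordinal (isT : 1 < 3)%N) (Ordinal (isT : 2 < 3)%N).
  have -> : h_fun a [set Ordinal (isT : 1 < 3)%N; Ordinal (isT : 2 < 3)%N]%SET = 0.
    rewrite /h_fun; case: eqP => // -[].
    by congr ([set _; _]%SET); apply/val_inj; rewrite /= inordK.
  rewrite wE // => /pair_weight_gt0 n12.
  move: n01 e01 n02 e02 n12; lia.
have neq (i j : 'I_r.+1) : (i < j)%N -> col (phi i) != col (phi j).
  move=> ij; have [_ /=] := H i j ij.
  rewrite blowup_weightE; first exact: pair_weight_gt0.
  by rewrite (inj_eq inj) neq_ltn ij.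
have cinj : injective (fun i : 'I_r.+1 => Ordinal (colr (phi i))).
  move=> i j /(congr1 val) /= E; apply/val_inj => /=.
  by case: (ltngtP i j) => // /neq; rewrite E eqxx.
by have := leq_card _ cinj; rewrite !card_ord ltnn.
Qed.

End PairWeight.

(** For [1 / 2 < a] the masses are proportional to [(d j)^-1], the equality case of Cauchy-Schwarz,
    so that every [d j * x j] equals [T^-1]. *)
Lemma optimal_distribution {R : realType} (r : nat) (a : R) : (0 < r)%N ->
  0 <= a <= 1 -> (r = 1%N -> 1 / 2 < a) ->
  exists k (x : 'I_k.+1 -> R), [/\ (k < r)%N, forall i, 0 <= x i, \sum_i x i = 1
    & forall j : 'I_k.+1, density_value r a <= \sum_i x i * pair_weight a i j].
Proof.
move=> r0 /andP [a0 a1] r1; rewrite /density_value.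
case: ifPn => [ah|]; last rewrite -ltNge => ah.
  (* Two classes joined by weight 1, with half the mass each; [r1] ensures that [r] is at least
     2. *)
  exists 1%N, (fun=> 1 / 2); split => [|i||j]; [|lra| |].
  - case: r r0 r1 => [|[|r]] // _ /(_ erefl) ?; lra.
  - by rewrite sumr_const card_ord; lra.
  rewrite !big_ord_recl big_ord0; case: j => [[|[|j]] Hj] //;
    rewrite /pair_weight /=; lra.
case: r r0 {r1} => // k _; set T := inv_defect _ _.
have ap : 0 < a by lra.
have bp : 0 < 2 * a - 1 by lra.
(* Only the last class can lack a partner, and only when [r] is odd. *)
pose matched (j : nat) := ~~ (odd k.+1 && (j == k)).
pose d j : R := if matched j then 2 * a - 1 else a.
have dp j : 0 < d j by rewrite /d; case: ifP.
have sumd : \sum_(j < k.+1) (d j)^-1 = T.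
  rewrite big_ord_recr /=; under eq_bigr => j _.
    rewrite /d /matched (ltn_eqF (ltn_ord j)) andbF /=; over.
  rewrite sumr_const card_ord /T /inv_defect /d /matched eqxx andbT /=.
  case: (odd k) => /=; rewrite ?subn0 ?subn1 /= -?natr1 -[_ *+ k]mulr_natl; ring.
have Tp : 0 < T.
  rewrite -sumd big_ord_recr /= ltr_wpDl ?invr_gt0 ?dp // sumr_ge0 // => j _.
  by rewrite invr_ge0 ltW.
exists k, (fun j => (d j)^-1 / T); split => // [i||j].
- by rewrite divr_ge0 ?invr_ge0 ?ltW.
- by rewrite -mulr_suml sumd divff // gt_eqF.
pose x (i : nat) := (d i)^-1 / T.
have x0 i : 0 <= x i by rewrite divr_ge0 ?invr_ge0 ?ltW.
(* Class [j] sees [a] from all the mass except its own, plus the excess [1 - a] from its partner if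
   there is one. *)
have -> : \sum_(i < k.+1) (d i)^-1 / T * pair_weight a i j =
   a - a * x j + (1 - a) * \sum_(i < k.+1 | (i != j) && (i./2 == j./2)) x i.
  have ax1 : \sum_(i < k.+1) a * x i = a.
    by rewrite -mulr_sumr -mulr_suml sumd divff ?mulr1 // gt_eqF.
  rewrite -[X in X - _ * x j]ax1 (bigD1 j) //= pair_weightxx mulr0 add0r.
  rewrite [in RHS](bigD1 j) //=.
  rewrite (addrC (a * x j)) addrK mulr_sumr big_mkcondr /= -big_split /=.
  apply: eq_bigr => i ij; rewrite /pair_weight val_eqE (negbTE ij) -/(x i).
  by case: ifP => _; ring.
have ax : a - d j * x j = a - T^-1.
  by rewrite /x mulrA divff ?mul1r // gt_eqF.
have [mj|mj] := boolP (matched j); last first.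
  rewrite -ax {1}/d (negbTE mj) lerDl mulr_ge0 ?sumr_ge0 //; lra.
have pk : ((if odd j then j.-1 else j.+1) < k.+1)%N.
  by move: mj (ltn_ord j); rewrite /matched /=; case: ifP; lia.
pose p := Ordinal pk.
have -> : a - T^-1 = a - a * x j + (1 - a) * x p.
  have -> : x p = x j.
    rewrite /x /d mj; suff -> : matched p by [].
    by move: mj (ltn_ord j); rewrite /matched /=; case: ifP; lia.
  by rewrite -ax {1}/d mj; ring.
rewrite lerD2l ler_wpM2l ?subr_ge0 // (bigD1 p) /=; last first.
  by rewrite -val_eqE /=; case: ifP; lia.
by rewrite lerDl sumr_ge0.
Qed.

Lemma blowup_lower {R : realType} (r : nat) (a : R) (ha : 0 <= a <= 1) :
  (0 < r)%N -> (r = 1%N -> 1 / 2 < a) -> forall n, exists2 x : R,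
  free_weights (forbidden r ha) n.+1 x &
  density_value r a * (1 - n.+1%:R^-1) <= x.
Proof.
move=> r0 r1 n; have [k [x [kr x0 x1 xA]]] := optimal_distribution r0 ha r1.
have [s sl] := greedy_sequence ord0 (fun i j : 'I_k.+1 => pair_weightC a i j)
  (fun i : 'I_k.+1 => pair_weightxx a i) x0 x1 xA n.+1.
(* Vertices are the positions in the greedy sequence, coloured by its entries. *)
pose col (u : 'I_n.+1) : nat := tnth s u.
exists (total_weight (complete_sgraph _) (blowup_weight a col)).
  exists (complete_sgraph _), (blowup_weight a col); split => //.
    exact: blowup_weighting.
  by apply: blowup_free => v; apply: leq_trans (ltn_ord _) kr.
have n0 : 0 < n.+1%:R :> R by rewrite ltr0n.
rewrite total_weight_qform card_ord ler_pdivlMr ?exprn_gt0 //.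
apply: le_trans (le_trans _ sl) _.
  rewrite le_eqVlt; apply/orP; left; apply/eqP; field.
  by rewrite nat1r gt_eqF.
rewrite big_tuple /qform; apply: ler_sum => u _; rewrite mul1r big_tuple.
by apply: ler_sum => v _; rewrite mul1r adj_blowup.
Qed.

(** * Existence of the maximum, closed form and limit *)

(* Rounding every weight up to the next value in [{0, a, 1}] keeps the graph free, so
   only finitely many weightings compete for the maximum. *)
Lemma beta_exists {R : realType} (r : nat) (a : R) (ha : 0 <= a <= 1) (n : nat) :
  (0 < r)%N -> exists b, is_beta (forbidden r ha) n b.
Proof.
move=> r0; have /andP [a0 a1] := ha.
pose val3 (i : 'I_3) : R := nth 0 [:: 0; a; 1] i.
pose wt (c : {ffun {set 'I_n} -> 'I_3}) e := val3 (c e).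
have val01 i : 0 <= val3 i <= 1.
  by case: i => [[|[|[|i]]] Hi] //; rewrite /val3 /= ?lexx ?ler01.
pose free c := `[< wfree (forbidden r ha) (complete_sgraph 'I_n) (wt c) >].
pose tw c := total_weight (complete_sgraph 'I_n) (wt c).
pose round (G : sgraph 'I_n) (w : {set 'I_n} -> R) : {ffun {set 'I_n} -> 'I_3} :=
  [ffun e => if (e \in edges G) && (a < w e) then inord 2
   else if (e \in edges G) && (0 < w e) then inord 1 else ord0].
(* 0 and [a] are the only thresholds in the forbidden cliques, and rounding up crosses neither. *)
have roundP G w e b : b = 0 \/ b = a -> b < wt (round G w) e ->
    e \in edges G /\ b < w e.
  move=> bE; have [b0 ba] : 0 <= b /\ b <= a by case: bE => ->.
  rewrite /wt ffunE; case: ifPn => [/andP [eG aw] _|_].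
    by split => //; apply: le_lt_trans ba aw.
  case: ifPn => [/andP [eG w0]|_]; rewrite /val3 /= ?inordK //=.
    by case: bE => ->; rewrite ?ltxx.
  by move=> /(le_lt_trans b0); rewrite ltxx.
have round_free G w : wfree (forbidden r ha) G w -> free (round G w).
  move=> wf; apply/asboolP => C FC [phi [inj H]]; apply: (wf C FC).
  exists phi; split => // i j ij; have [_ ] := H i j ij; apply: roundP.
  case: FC phi inj H i j ij => -> /= phi _ _ i j _; last by left.
  by rewrite /h_fun; case: ifP; [left|right].
have round_le G w e : edge_weighting G w -> e \in edges G -> w e <= wt (round G w) e.
  move=> w01 eG; have /andP [w0 w1] := w01 e eG; rewrite /wt ffunE eG /=.
  case: ltP => aw; rewrite /val3; first by rewrite inordK.
  by case: ltP => //= _; rewrite inordK.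
have tw_le G w : edge_weighting G w -> total_weight G w <= tw (round G w).
  move=> w01; rewrite /tw /total_weight; apply: ler_wpM2l.
    by rewrite divr_ge0 ?exprn_ge0.
  rewrite big_mkcond [leRHS]big_mkcond; apply: ler_sum => e _.
  rewrite inE; case: ifPn => eG; first by rewrite (edges_card2 eG) round_le.
  by case: ifP => // _; case/andP: (val01 (round G w e)).
(* The zero weighting is free, so the maximum ranges over a nonempty set; [r0] gives [Kclique r.+1]
   at least one pair. *)
have free0 : free [ffun=> ord0].
  apply/asboolP => C [] -> [phi [_ H]].
    have [_] := H ord0 (inord 1) ltac:(by rewrite inordK).
    rewrite /wt ffunE /= /h_fun; case: ifP => _; first by rewrite ltxx.
    by move/(le_lt_trans a0); rewrite ltxx.
  have [_] := H ord0 (Ordinal (r0 : 1 < r.+1)%N) isT.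
  by rewrite /wt ffunE /= ltxx.
have [c /asboolP cfree cmax] := @arg_maxP _ R _ [ffun=> ord0] free tw free0.
exists (tw c); split.
  exists (complete_sgraph _), (wt c); split => // e _; exact: val01.
move=> _ [G [w [w01 wf ->]]]; apply: le_trans (tw_le G w w01) _.
by apply: cmax; apply: round_free.
Qed.

(** [inv_defect r a] collapses to [r / (2a - 1)] for even [r] and to [(a(r + 1) - 1) / (a(2a - 1))]
    for odd [r]. *)
Lemma density_valueE {R : realType} (r : nat) (a : R) : (0 < r)%N ->
  density_value r a =
    (if a <= 1 / 2 then 1 / 2
     else if ~~ odd r then a + (1 - 2 * a) / r%:R
     else a ^+ 2 * (r%:R - 1) / (a * (r%:R + 1) - 1)).
Proof.
move=> r0; rewrite /density_value; case: ifPn => //; rewrite -ltNge => ah.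
have ap : a != 0 by rewrite gt_eqF //; lra.
have bp : 2 * a - 1 != 0 by rewrite gt_eqF //; lra.
have r1 : 1 <= r%:R :> R by rewrite ler1n.
have rp : r%:R != 0 :> R by rewrite gt_eqF //; lra.
have dp : a * (r%:R + 1) - 1 != 0 by rewrite gt_eqF //; nra.
rewrite /inv_defect natrB; last by case: odd.
case: (odd r) => /=; last first.
  have -> : r%:R / a + (r%:R - 0) * ((2 * a - 1)^-1 - a^-1) = r%:R / (2 * a - 1) :> R.
    by field; rewrite ap bp.
  by field; rewrite rp bp.
have -> : r%:R / a + (r%:R - 1) * ((2 * a - 1)^-1 - a^-1) =
    (a * (r%:R + 1) - 1) / (a * (2 * a - 1)) :> R.
  by field; rewrite ap bp.
by field; rewrite ap bp dp.
Qed.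

(* The hypothesis hr1 excludes exactly the case r = 1, a <= 1/2, where K_2^0 is
   forbidden, hence d(F) = 0 and not 1/2. *)
Theorem theorem3p6 (R : realType) (r : nat) (a : R) (hr : (0 < r)%N)
    (ha : 0 <= a <= 1) (hr1 : r = 1%N -> 1 / 2 < a) :
  is_density (forbidden r ha)
    (if a <= 1 / 2 then 1 / 2
     else if ~~ odd r then a + (1 - 2 * a) / r%:R
     else a ^+ 2 * (r%:R - 1) / (a * (r%:R + 1) - 1)).
Proof.
rewrite -density_valueE //.
have [beta betaP] := choice (fun n => beta_exists ha n hr).
exists beta; split => //; rewrite -cvg_shiftS /=.
apply: (@squeeze_cvgr _ _ _ _
  (fun n => density_value r a * (1 - n.+1%:R^-1)) (fun=> density_value r a)).
- apply: nearW => n; have [[G [w [w01 wf ->]]] ub] := betaP n.+1.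
  apply/andP; split; last by apply: total_weight_le wf => //; rewrite card_ord.
  have [x xfree lx] := blowup_lower ha hr hr1 n.
  exact: le_trans lx (ub _ xfree).
- suff : (density_value r a * (1 - n.+1%:R^-1) @[n --> \oo] -->
      density_value r a * (1 - 0))%classic by rewrite subr0 mulr1.
  apply: cvgM; first exact: cvg_cst.
  by apply: cvgB; [exact: cvg_cst|exact: cvg_harmonic].
- exact: cvg_cst.
Qed.
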